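(* Let $B\subset\mathbb{R}^d$ be a convex body, let $\Lambda\subset\mathbb{R}^d$ be a lattice and let $c\in\Lambda^*$ be a non-zero vector. Let $\phi:B\cap\Lambda\to\mathbb{Z}$, $\phi(x)=\langle c,x\rangle$, and $Y=\phi(B\cap\Lambda)$. Suppose $\operatorname{width}(B,c)\le 2\operatorname{width}(B)$. Then for any $y_1,y_2\in Y$ with $y_2-y_1>2\omega(d)$ there exists $y\in Y$ with $y_1<y<y_2$.
   Context: A convex body is a convex compact set. A lattice is a discrete additive subgroup of $\mathbb{R}^d$ of rank $d$; $\Lambda^*=\{c\in\mathbb{R}^d:\langle c,x\rangle\in\mathbb{Z}\text{ for all }x\in\Lambda\}$ is the dual lattice. For non-zero $c\in\Lambda^*$, $\operatorname{width}(B,c)=\max_{x\in B}\langle c,x\rangle-\min_{x\in B}\langle c,x\rangle$, and $\operatorname{width}(B)=\min_{c\in\Lambda^*\setminus\{0\}}\operatorname{width}(B,c)$ is the lattice width of $B$ (with respect to $\Lambda$). $\omega(d)$ denotes a constant (depending only on $d$) such that for every lattice $\Lambda\subset\mathbb{R}^d$ and every convex body $B\subset\mathbb{R}^d$ with $B\cap\Lambda=\emptyset$ one has $\operatorname{width}(B)\le\omega(d)$ (such a constant exists). *)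

(* Defs.v *)
From HB Require Import structures.
From mathcomp Require Import all_boot all_order all_algebra.
From mathcomp Require Import all_classical all_reals all_analysis.

Set Implicit Arguments.
Unset Strict Implicit.
Unset Printing Implicit Defensive.

Import Order.TTheory GRing.Theory Num.Theory.
Import numFieldNormedType.Exports.

Local Open Scope classical_set_scope.
Local Open Scope ring_scope.

Definition dot (R : realType) (d : nat) (u v : 'rV[R]_d) : R :=
  \sum_i u 0 i * v 0 i.

Definition convex_body (R : realType) (d : nat) (B : set 'rV[R]_d) : Prop :=
  convex_set B /\ compact B.

Definition additive_subgroup (R : realType) (d : nat) (L : set 'rV[R]_d) :
    Prop :=
  L 0 /\ forall x y, L x -> L y -> L (x - y).

Definition discrete_subset (R : realType) (d : nat) (L : set 'rV[R]_d) : Prop :=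
  L `<=` isolated L.

(* The rank of L is the dimension of its real linear span, that is, the largest
   number of linearly independent vectors of L; for discrete subgroups this is
   also the rank as an abelian group. *)
Definition has_rank (R : realType) (d : nat) (L : set 'rV[R]_d) (r : nat) :
    Prop :=
  (exists A : 'M[R]_(r, d), (forall i, L (row i A)) /\ row_free A) /\
  (forall (s : nat) (A : 'M[R]_(s, d)),
     (forall i, L (row i A)) -> row_free A -> (s <= r)%N).

Definition is_lattice (R : realType) (d : nat) (L : set 'rV[R]_d) : Prop :=
  [/\ additive_subgroup L, discrete_subset L & has_rank L d].

Definition dual_lattice (R : realType) (d : nat) (L : set 'rV[R]_d) :
    set 'rV[R]_d :=
  [set c | forall x, L x -> dot c x \is a Num.int].

(* On a nonempty compact set the supremum and the infimum are attained, see
   dot_max and dot_min below. *)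
Definition width_along (R : realType) (d : nat) (B : set 'rV[R]_d)
    (c : 'rV[R]_d) : R :=
  sup [set dot c x | x in B] - inf [set dot c x | x in B].

(* An infimum rather than a minimum: for a body with empty interior the minimum
   may fail to exist (a segment whose direction is irrational with respect to
   the lattice, for instance). *)
Definition lattice_width (R : realType) (d : nat) (L B : set 'rV[R]_d) : R :=
  inf [set width_along B c | c in dual_lattice L `\ 0].

(* Nonemptiness is required because the width of the empty set is undefined. *)
Definition flatness_constant (R : realType) (d : nat) (omega : R) : Prop :=
  forall L B : set 'rV[R]_d, is_lattice L -> convex_body B -> B !=set0 ->
    B `&` L = set0 -> lattice_width L B <= omega.

Lemma dot_continuous (R : realType) (d : nat) (c : 'rV[R]_d) :
  continuous (dot c).
Proof.
move=> x; rewrite /dot.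
apply: (@cvg_big _ _ +%R 0 xpredT add_continuous _ (nbhs x)) => i _.
by apply: cvgM; [exact: cvg_cst|exact: coord_continuous].
Qed.

Lemma dot_max (R : realType) (d : nat) (B : set 'rV[R]_d) (c : 'rV[R]_d) :
  compact B -> B !=set0 ->
  exists2 x, B x & (forall y, B y -> dot c y <= dot c x) /\
                   sup [set dot c y | y in B] = dot c x.
Proof.
move=> cB B0.
have [x /set_mem Bx xP] := compact_EVT_max B0 cB
  (continuous_subspaceT (@dot_continuous _ _ c)).
have {}xP y : B y -> dot c y <= dot c x by move=> /mem_set/xP.
have ubx : ubound [set dot c y | y in B] (dot c x) by move=> _ [y /xP ? <-].
exists x => //; split=> //; apply/eqP; rewrite eq_le ge_sup//=; last first.
  by exists (dot c x), x.
by apply: ub_le_sup; [exists (dot c x)|exists x].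
Qed.

Lemma dot_min (R : realType) (d : nat) (B : set 'rV[R]_d) (c : 'rV[R]_d) :
  compact B -> B !=set0 ->
  exists2 x, B x & (forall y, B y -> dot c x <= dot c y) /\
                   inf [set dot c y | y in B] = dot c x.
Proof.
move=> cB B0.
have [x /set_mem Bx xP] := compact_EVT_min B0 cB
  (continuous_subspaceT (@dot_continuous _ _ c)).
have {}xP y : B y -> dot c x <= dot c y by move=> /mem_set/xP.
have lbx : lbound [set dot c y | y in B] (dot c x) by move=> _ [y /xP ? <-].
exists x => //; split=> //; apply/eqP; rewrite eq_le lb_le_inf//=; last first.
  by exists (dot c x), x.
by rewrite andbT; apply: ge_inf; [exists (dot c x)|exists x].
Qed.

(* Main.v *)
Require Import Defs.
From mathcomp Require Import all_boot all_order all_algebra.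
From mathcomp Require Import all_classical all_reals all_analysis.
From mathcomp Require Import ring lra zify.
Set Implicit Arguments.
Unset Strict Implicit.
Unset Printing Implicit Defensive.
Import Order.TTheory GRing.Theory Num.Theory.
Import numFieldNormedType.Exports.
Local Open Scope classical_set_scope.
Local Open Scope ring_scope.

(** A homothetic copy [B' = v + t B] of [B] with [0 <= t <= 1] and center in
    [B] lies in [B], and its lattice width is at least [t * width(B)]. Put
    [l := (y2 - y1) / 2 + omega], so that [2 omega < l < y2 - y1]. With ratio
    [t := l / width(B, c)] and a suitable center on the segment joining the
    lattice points over [y1] and [y2], the values of [c] on [B'] fill an
    interval strictly inside [(y1, y2)]. Since
    [width(B') >= t * width(B, c) / 2 = l / 2 > omega], the body [B'] contains
    a lattice point, and this point maps strictly between [y1] and [y2]. *)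

Section dot_product.
Context {R : realType} {d : nat}.
Implicit Types u v w : 'rV[R]_d.

Lemma dotDr u v w : dot u (v + w) = dot u v + dot u w.
Proof. by rewrite /dot -big_split; apply: eq_bigr => i _; rewrite mxE mulrDr. Qed.

Lemma dotZr a u v : dot u (a *: v) = a * dot u v.
Proof. by rewrite /dot mulr_sumr; apply: eq_bigr => i _; rewrite mxE mulrCA. Qed.

Lemma dot_gt0 u : u <> 0 -> 0 < dot u u.
Proof.
move=> u0; have u_ge0 i : true -> 0 <= u 0 i * u 0 i by rewrite -expr2 sqr_ge0.
rewrite lt_def sumr_ge0// andbT; apply/negP => /eqP dot0; apply: u0.
apply/rowP => i; rewrite mxE; apply/eqP; rewrite -[_ == 0]orbb -mulf_eq0.
exact/eqP/(psumr_eq0P u_ge0 dot0).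
Qed.

End dot_product.

Section convex_bodies.
Context {R : realType} {d : nat}.
Implicit Types (B : set 'rV[R]_d) (c v x y : 'rV[R]_d) (t : R).

Lemma convex_set_comb B x y t : convex_set B -> B x -> B y -> 0 <= t <= 1 ->
  B (t *: x + (1 - t) *: y).
Proof.
move=> convB Bx By t01.
exact: (set_mem (convB x y (Itv01 (andP t01).1 (andP t01).2)
                       (mem_set Bx) (mem_set By))).
Qed.

Lemma convex_body_affine B v t :
  convex_body B -> convex_body [set v + t *: x | x in B].
Proof.
move=> [convB compB]; split; last first.
  apply: continuous_compact compB; apply: continuous_subspaceT => x.
  exact: (continuousD (cvg_cst v) (@scaler_continuous R _ t x)).
move=> _ _ k /set_mem[x Bx <-] /set_mem[y By <-]; apply/mem_set.
exists (k%:inum *: x + (1 - k%:inum) *: y).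
  exact: (set_mem (convB x y k (mem_set Bx) (mem_set By))).
(* Affine maps preserve convex combinations; unfolding the abstract combination leaves an identity
   that [ring] checks entrywise. *)
change (v + t *: (k%:inum *: x + (1 - k%:inum) *: y) =
  k%:inum *: (v + t *: x) + (1 - k%:inum) *: (v + t *: y)).
by apply/rowP => i; rewrite !mxE; ring.
Qed.

Lemma convex_body_set1 v : convex_body [set v].
Proof.
split; last exact: compact_set1.
by move=> _ _ k /set_mem -> /set_mem ->; rewrite convmm inE.
Qed.

Lemma width_along_ge0 B c : compact B -> B !=set0 -> 0 <= width_along B c.
Proof.
move=> cB B0; rewrite /width_along.
have [x Bx [xP ->]] := dot_max c cB B0; have [y By [yP ->]] := dot_min c cB B0.
by rewrite subr_ge0 xP.
Qed.

(** The images of a maximizer and a minimizer of [c] on [B] lie in the copy, and their values differ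
    by [t * width_along B c]. *)
Lemma width_along_affine_ge B c v t : compact B -> B !=set0 -> 0 <= t ->
  compact [set v + t *: x | x in B] ->
  t * width_along B c <= width_along [set v + t *: x | x in B] c.
Proof.
move=> cB B0 t0 cB'; rewrite /width_along.
have B'0 : [set v + t *: x | x in B] !=set0 by exact: image_nonempty.
have [x Bx [xP ->]] := dot_max c cB B0; have [y By [yP ->]] := dot_min c cB B0.
have [x' _ [x'P ->]] := dot_max c cB' B'0.
have [y' _ [y'P ->]] := dot_min c cB' B'0.
have := x'P _ (imageP _ Bx); have := y'P _ (imageP _ By).
by rewrite !dotDr !dotZr; lra.
Qed.

Lemma lattice_width_ge0 (L : set 'rV[R]_d) B :
  compact B -> B !=set0 -> 0 <= lattice_width L B.
Proof.
move=> cB B0; rewrite /lattice_width.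
(* If there is no nonzero dual vector, [inf] takes its default value 0. *)
have [->|/set0P S0] :=
  eqVneq [set width_along B c | c in dual_lattice L `\ 0] set0.
  by rewrite inf0.
by apply: lb_le_inf => // _ [c _ <-]; exact: width_along_ge0.
Qed.

Lemma lattice_width_le (L : set 'rV[R]_d) B c : compact B -> B !=set0 ->
  dual_lattice L c -> c <> 0 -> lattice_width L B <= width_along B c.
Proof.
move=> cB B0 Lc c0; apply: ge_inf; last by exists c.
by exists 0 => _ [c' _ <-]; exact: width_along_ge0.
Qed.

(** The bound holds along each dual vector [c'] separately; [c] witnesses that the infimum is over a
    nonempty set. *)
Lemma lattice_width_affine_ge (L : set 'rV[R]_d) B c v t : convex_body B ->
  B !=set0 -> dual_lattice L c -> c <> 0 -> 0 <= t ->
  t * lattice_width L B <= lattice_width L [set v + t *: x | x in B].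
Proof.
move=> hB B0 Lc c0 t0; have [_ cB] := hB.
have [_ cB'] := convex_body_affine v t hB.
apply: lb_le_inf => [|_ [c' [Lc' c'0] <-]].
  by exists (width_along [set v + t *: x | x in B] c), c.
apply: le_trans (width_along_affine_ge c' cB B0 t0 cB').
by apply: ler_wpM2l => //; exact: lattice_width_le.
Qed.

(* The singleton of a point [v] with [dot c v = 1 / 2] misses [L]. *)
Lemma flatness_constant_ge0 (omega : R) (L : set 'rV[R]_d) c :
  flatness_constant d omega -> is_lattice L -> dual_lattice L c -> c <> 0 ->
  0 <= omega.
Proof.
move=> homega hL Lc c0; pose v := (2 * dot c c)^-1 *: c.
have cv : dot c v = 2^-1.
  by rewrite dotZr invfM -mulrA mulVf ?mulr1// gt_eqF// dot_gt0.
have v0 : [set v] !=set0 by exists v.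
apply: le_trans (homega L [set v] hL (convex_body_set1 v) v0 _).
  by apply: lattice_width_ge0 => //; exact: compact_set1.
apply/seteqP; split => // x [-> /Lc]; rewrite cv => /intrP[z /esym zE].
have : (2 * z)%:~R = 1%:~R :> R by rewrite intrM zE mulfV// pnatr_eq0.
by move/intr_inj => ?; lia.
Qed.

End convex_bodies.

(* [s] is the position of the homothety center on the segment [y1, y2]. *)
Lemma slab_homothety (R : realFieldType) (m M y1 y2 l : R) :
  m <= y1 -> y2 <= M -> 0 <= l -> l < y2 - y1 ->
  exists t s, [/\ 0 <= t <= 1, 0 <= s <= 1, t * (M - m) = l &
    forall z, m <= z <= M ->
      y1 < (1 - t) * (s * y2 + (1 - s) * y1) + t * z < y2].
Proof.
move=> my1 y2M l0 lt_l; have W0 : 0 < M - m by lra.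
pose t := l / (M - m); have tW : t * (M - m) = l by rewrite divfK// gt_eqF.
have t0 : 0 <= t by rewrite divr_ge0// ltW.
have t1 : t < 1 by rewrite ltr_pdivrMr// mul1r; lra.
(* The position [n / k] centers the image of [[m, M]], of length [l], in [[y1, y2]]: a gap
   [(y2 - y1 - l) / 2] remains at each end. *)
pose n := (y2 - y1 - l) / 2 + t * (y1 - m); pose k := (1 - t) * (y2 - y1).
have k0 : 0 < k by rewrite mulr_gt0//; lra.
have ty1 : 0 <= t * (y1 - m) by rewrite mulr_ge0//; lra.
have ty2 : 0 <= t * (M - y2) by rewrite mulr_ge0//; lra.
have nk : n / k * k = n by rewrite divfK// gt_eqF.
exists t, (n / k); split=> //.
- by rewrite t0 ltW.
- rewrite divr_ge0 ?(ltW k0)//=; last by rewrite /n; lra.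
  (* Here [k - n = (y2 - y1 - l) / 2 + t * (M - y2)]. *)
  by rewrite ler_pdivrMr// mul1r /n /k; lra.
- move=> z /andP[mz zM].
  have tz1 : 0 <= t * (z - m) by rewrite mulr_ge0//; lra.
  have tz2 : 0 <= t * (M - z) by rewrite mulr_ge0//; lra.
  have -> : (1 - t) * (n / k * y2 + (1 - n / k) * y1) + t * z =
      n / k * k + (1 - t) * y1 + t * z by rewrite /k; ring.
  by rewrite nk /n; apply/andP; split; lra.
Qed.

Theorem theorem4p3 (R : realType) (d : nat) (omega : R)
    (homega : flatness_constant d omega)
    (B : set 'rV[R]_d) (hB : convex_body B)
    (L : set 'rV[R]_d) (hL : is_lattice L)
    (c : 'rV[R]_d) (hc : dual_lattice L c) (hc0 : c <> 0)
    (phi : 'rV[R]_d -> int)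
    (hphi : forall x, (B `&` L) x -> (phi x)%:~R = dot c x)
    (hwidth : width_along B c <= 2 * lattice_width L B)
    (y1 y2 : int) (hy1 : (phi @` (B `&` L)) y1) (hy2 : (phi @` (B `&` L)) y2)
    (hy : 2 * omega < (y2 - y1)%:~R) :
  exists2 y : int, (phi @` (B `&` L)) y & y1 < y < y2.
Proof.
have omega0 := flatness_constant_ge0 homega hL hc hc0.
have [x1 BLx1 phi1] := hy1; have [x2 BLx2 phi2] := hy2.
have [[Bx1 _] [Bx2 _]] := (BLx1, BLx2).
have dot1 : y1%:~R = dot c x1 by rewrite -phi1 hphi.
have dot2 : y2%:~R = dot c x2 by rewrite -phi2 hphi.
have [convB cB] := hB; have B0 : B !=set0 by exists x1.
have [xM BxM [xMP supE]] := dot_max c cB B0.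
have [xm Bxm [xmP infE]] := dot_min c cB B0.
move: hwidth; rewrite /width_along supE infE => hW.
move: hy; rewrite intrB dot1 dot2 => hD.
pose l := (dot c x2 - dot c x1) / 2 + omega.
(* Here [0 <= l] relies on [omega0], and [l < y2 - y1] on [hD]. *)
have [||||t [s [t01 s01 tW slab]]] := @slab_homothety _ (dot c xm) (dot c xM)
  (dot c x1) (dot c x2) l; rewrite ?xMP ?xmP//; [clear hc0; rewrite /l; lra..|].
pose p := s *: x2 + (1 - s) *: x1; pose v := (1 - t) *: p.
have Bp : B p by exact: convex_set_comb.
have t0 : 0 <= t by case/andP: t01.
have : [set v + t *: x | x in B] `&` L !=set0.
  apply/set0P/negP => /eqP noL.
  have := homega _ _ hL (convex_body_affine v t hB) (image_nonempty _ B0) noL.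
  have := lattice_width_affine_ge v hB B0 hc hc0 t0.
  (* An empty intersection would give [l <= 2 * t * lattice_width L B <= 2 * omega < l]. *)
  have := ler_wpM2l t0 hW; rewrite tW /l; clear hc0; lra.
move=> [_ [[x Bx <-] Lx]].
(* Since [v = (1 - t) *: p], this point is a convex combination of [x] and [p]. *)
have Bvx : B (v + t *: x) by rewrite addrC; exact: convex_set_comb.
exists (phi (v + t *: x)); first by exists (v + t *: x).
rewrite -(ltr_int R) -[X in _ && X](ltr_int R) dot1 dot2 hphi//.
by rewrite !(dotDr, dotZr) slab// xMP// xmP.
Qed.
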